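(* Let $R_d$ ($d\ge 0$) be the graphs defined in the context. Then for all $d\ge 0$: $|SC(R_d)| = \frac{1}{4}\left(3\cdot 5^{d+1}-8d-11\right)$, $5^d\le |SC(R_d)|\le 5^{d+1}$, $|SBL(R_d)| = \frac{1}{2}\left(5^{d+1}-1\right)$, and $5^d\le |SBL(R_d)|\le 5^{d+1}$.
   Context: $R_0$ is a $3$-cycle with vertices $a_0,b_0,c_0$. Given $R_d$ containing a triangle on vertices $a_d,b_d,c_d$, construct $R_{d+1}$ as follows: for each pair $\{x,y\}\subset\{a,b,c\}$ with third letter $z$, subdivide the edge $\{x_d,y_d\}$ by a new vertex $z'_d$; add three new vertices $a_{d+1},b_{d+1},c_{d+1}$, the edges $\{a'_d,a_{d+1}\},\{b'_d,b_{d+1}\},\{c'_d,c_{d+1}\}$, and the edges of a triangle on $a_{d+1},b_{d+1},c_{d+1}$. $SC(R_d)$ is the set of simple cycles of $R_d$, and $SBL(R_d)$ is the set of simple paths in $R_d$ from $a_0$ to $b_0$. *)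

(* Defs.v *)
From mathcomp Require Import all_boot.

Set Implicit Arguments.
Unset Strict Implicit.
Unset Printing Implicit Defensive.

(** The letters [a], [b], [c] are the elements of ['I_3]. *)
Definition la : 'I_3 := @Ordinal 3 0 isT.
Definition lb : 'I_3 := @Ordinal 3 1 isT.

(** A graph with two distinguished triples of vertices: [outer] tracks
    [a_0, b_0, c_0], and [inner] the current triangle [a_d, b_d, c_d]. *)
Record tgraph := TGraph {
  vtx : finType;
  adj : rel vtx;
  outer : 'I_3 -> vtx;
  inner : 'I_3 -> vtx
}.

Section Step.

Variable G : tgraph.

(** [inl (inl u)] is the old vertex [u], [inl (inr z)] is the subdividing
    vertex [z'_d], and [inr z] is the new triangle vertex [z_{d+1}]. *)
Definition step_vtx : finType := (vtx G + 'I_3 + 'I_3)%type.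

Definition step_adj (u v : step_vtx) : bool :=
  match u, v with
  | inl (inl x), inl (inl y) =>
      adj x y && ~~ ((x \in codom (@inner G)) && (y \in codom (@inner G)))
  | inl (inl x), inl (inr z) | inl (inr z), inl (inl x) =>
      [exists t : 'I_3, (t != z) && (x == inner G t)]
  | inl (inr z), inr w | inr w, inl (inr z) => z == w
  | inr z, inr w => z != w
  | _, _ => false
  end.

Definition step : tgraph :=
  @TGraph step_vtx step_adj (fun t => inl (inl (outer G t))) (fun t => inr t).

End Step.

Definition R (d : nat) : tgraph :=
  iter d step (@TGraph 'I_3 (fun x y => x != y) id id).

Section PathsAndCycles.

Variables (V : finType) (e : rel V).

Definition cycle_edges (c : seq V) : {set {set V}} :=
  [set [set x; next c x] | x in c].

(** A simple cycle is a subgraph, given by its set of edges, so that neither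
    the starting point nor the direction of traversal matters. *)
Definition simple_cycles : {set {set {set V}}} :=
  \bigcup_(n < #|V|.+1)
    [set cycle_edges t | t : n.-tuple V & (2 < n) && ucycleb e t].

Definition bounded_seq : finType := {n : 'I_#|V| & n.-tuple V}.

Definition seq_of (p : bounded_seq) : seq V := tagged p.

(** A simple path from [x] to [y] is the sequence [x :: seq_of p]; the bound
    on the length of [seq_of p] excludes no simple path. *)
Definition simple_paths (x y : V) : {set bounded_seq} :=
  [set p | [&& path e x (seq_of p), uniq (x :: seq_of p)
             & last x (seq_of p) == y]].

Lemma simple_cyclesP (E : {set {set V}}) :
  reflect (exists c : seq V, [/\ 2 < size c, ucycle e c & E = cycle_edges c])
          (E \in simple_cycles).
Proof.
apply: (iffP bigcupP) => [[n _ /imsetP[t]]|[c [c2 ec ->]]].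
  by rewrite inE => /andP[n2 et] ->; exists t; rewrite size_tuple.
have /andP[_ uc] := ec.
have cV : size c < #|V|.+1 by rewrite ltnS -(card_uniqP uc) max_card.
exists (Ordinal cV) => //; apply/imsetP; exists (in_tuple c) => //.
by rewrite inE c2.
Qed.

Lemma simple_pathsP (x y : V) (s : seq V) :
  reflect (exists2 p, p \in simple_paths x y & seq_of p = s)
          [&& path e x s, uniq (x :: s) & last x s == y].
Proof.
apply: (iffP idP) => [xs|[p]]; last by rewrite inE => h <-.
have /and3P[_ us _] := xs.
have sV : size s < #|V| by rewrite -[_.+1](card_uniqP us) max_card.
exists (existT (fun n : 'I_#|V| => n.-tuple V) (Ordinal sV) (in_tuple s)) => //.
by rewrite inE.
Qed.

Lemma seq_of_inj : injective seq_of.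
Proof.
move=> [n t] [m u]; rewrite /seq_of /= => tu.
have nm : n = m by apply: val_inj; rewrite /= -(size_tuple t) tu size_tuple.
by case: m / nm u tu => u /val_inj ->.
Qed.

End PathsAndCycles.

Definition SC (d : nat) : {set {set {set vtx (R d)}}} :=
  simple_cycles (@adj (R d)).

Definition SBL (d : nat) : {set bounded_seq (vtx (R d))} :=
  simple_paths (@adj (R d)) (outer (R d) la) (outer (R d) lb).

Lemma R_sym d : symmetric (@adj (R d)).
Proof.
elim: d => [|d IH] [] //=; first by move=> m i [n j]; rewrite eq_sym.
  by case=> [x|z] [[y|w]|w] //=; rewrite IH [(y \in _) && _]andbC.
by move=> z [[]|w] //=; rewrite eq_sym.
Qed.

Lemma R_irr d : irreflexive (@adj (R d)).
Proof. by elim: d => [|d IH] => [x|[[x|z]|z]] //=; rewrite ?eqxx ?IH. Qed.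

Lemma R_triangle d (x y : 'I_3) : adj (inner (R d) x) (inner (R d) y) = (x != y).
Proof. by case: d. Qed.

(* Main.v *)
Require Import Defs.
From mathcomp Require Import all_boot all_order all_algebra.
From mathcomp Require Import zify lra.
Import Order.TTheory GRing.Theory Num.Theory.

(** [R_{d+1}] arises from [R_d] by replacing the innermost triangle, but it is
    also, up to isomorphism, a hexagon [a_0 c'_0 b_0 a'_0 c_0 b'_0] wrapped
    around a copy of [R_d] and joined to the outer triangle of that copy by
    the three spokes at [a'_0, b'_0, c'_0]. A simple path between two of
    [a_0, b_0, c_0], or a simple cycle, uses at most two spokes, so it visits the
    copy of [R_d] at most once and in a single simple path between two outer
    vertices. Writing [P_d] and [C_d] for the numbers of such paths and of
    cycles, one reads off [P_{d+1} = 5 P_d + 2] and [C_{d+1} = C_d + 1 + 6 P_d]: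
    two paths stay in the hexagon and five patterns make a detour; a cycle is
    inside the copy, or the hexagon itself, or one of the two arcs between one
    of the three pairs of spokes closed up by a path in the copy. *)

Set Implicit Arguments.
Unset Strict Implicit.

(** * Wrapping a graph in a hexagon, and the isomorphism with the recursive construction *)

Definition hexagon : finType := ('I_3 + 'I_3)%type.

Definition hexagon_adj (h k : hexagon) : bool :=
  match h, k with
  | inl t, inr z | inr z, inl t => t != z
  | _, _ => false
  end.

(** [inl (inl t)] is the new outer vertex [t_0], [inl (inr z)] is the vertex
    [z'_0] and [inr v] is the vertex [v] of the wrapped graph. *)
Definition wrap_adj (G : tgraph) (u v : hexagon + vtx G) : bool :=
  match u, v with
  | inl h, inl k => hexagon_adj h k
  | inl (inr z), inr v | inr v, inl (inr z) => v == outer G z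
  | inr x, inr y => adj x y
  | _, _ => false
  end.

Definition wrap (G : tgraph) : tgraph :=
  @TGraph (hexagon + vtx G)%type (@wrap_adj G)
    (fun t => inl (inl t)) (fun t => inr (inner G t)).

(** The inner vertices must be matched for [step] to respect isomorphism, the outer ones because the
    paths are counted between them. *)
Definition tgraph_iso (G H : tgraph) : Prop :=
  exists f : vtx G -> vtx H,
    [/\ bijective f, {mono f : u v / adj u v},
        forall t, f (outer G t) = outer H t
      & forall t, f (inner G t) = inner H t].

Lemma tgraph_iso_trans (G H K : tgraph) :
  tgraph_iso G H -> tgraph_iso H K -> tgraph_iso G K.
Proof.
case=> f [fb fa fo fi] [g [gb ga go gi]]; exists (g \o f); split => [|u v|t|t] /=.
- exact: bij_comp.
- by rewrite ga fa.
- by rewrite fo go.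
- by rewrite fi gi.
Qed.

Lemma codom_inj (T : finType) (U V : eqType) (f : T -> U) (g : U -> V)
    (h : T -> V) (x : U) :
  injective g -> (forall t, g (f t) = h t) -> (g x \in codom h) = (x \in codom f).
Proof.
move=> g_inj gf; apply/codomP/codomP => [[t]|[t ->]]; last by exists t; rewrite gf.
by rewrite -gf => /g_inj ->; exists t.
Qed.

Lemma step_iso (G H : tgraph) : tgraph_iso G H -> tgraph_iso (step G) (step H).
Proof.
case=> f [fb fa fo fi]; have f_inj := bij_inj fb.
pose F (u : vtx (step G)) : vtx (step H) :=
  match u with
  | inl (inl x) => inl (inl (f x)) | inl (inr z) => inl (inr z) | inr z => inr z
  end.
have Fex x z : [exists t, (t != z) && (f x == inner H t)]
             = [exists t, (t != z) && (x == inner G t)].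
  by apply: eq_existsb => t; rewrite -fi inj_eq.
exists F; split => [|u v|t|t] //; last by rewrite /= fo.
  case: fb => g fK gK.
  by exists (fun u => match u with
    | inl (inl x) => inl (inl (g x)) | inl (inr z) => inl (inr z) | inr z => inr z
    end); case=> [[x|z]|z] //=; rewrite ?fK ?gK.
case: u v => [[x|z]|z] [[y|w]|w] //=.
by rewrite fa !(@codom_inj _ _ _ (inner G) f).
Qed.

(** The two operations act at opposite ends of the graph and so commute; on vertices the isomorphism
    only reassociates the sums. *)
Lemma step_wrap_iso (G : tgraph) : tgraph_iso (step (wrap G)) (wrap (step G)).
Proof.
pose F (u : vtx (step (wrap G))) : vtx (wrap (step G)) :=
  match u with
  | inl (inl (inl h)) => inl h
  | inl (inl (inr x)) => inr (inl (inl x))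
  | inl (inr z) => inr (inl (inr z))
  | inr z => inr (inr z)
  end.
have inlF h : ((inl h : vtx (wrap G)) \in codom (inner (wrap G))) = false.
  by apply/codomP => -[].
exists F; split => // [|u v].
  by exists (fun u => match u with
    | inl h => inl (inl (inl h))
    | inr (inl (inl x)) => inl (inl (inr x))
    | inr (inl (inr z)) => inl (inr z)
    | inr (inr z) => inr z
    end); [case=> [[[h|x]|z]|z] | case=> [h|[[x|z]|z]]].
case: u v => [[[h|x]|z]|z] [[[k|y]|w]|w] //=;
  rewrite ?inlF ?andbF ?andbT //.
- by case: h => // t; apply/esym/existsP=> -[j]; rewrite andbF.
- by case: h.
- by rewrite !(@codom_inj _ _ _ (inner G) inr) // => a b [].
- by case: k => // t; apply/esym/existsP=> -[j]; rewrite andbF.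
- by case: k.
Qed.

Lemma R_wrap_iso (d : nat) : tgraph_iso (R d.+1) (wrap (R d)).
Proof.
elim: d => [|d IH]; last first.
  apply: (@tgraph_iso_trans _ (step (wrap (R d)))); first exact: step_iso.
  exact: step_wrap_iso.
(* For [d = 0] both vertex types are ['I_3 + 'I_3 + 'I_3]. Every old vertex lies on the inner
   triangle, so all old edges disappear and the hexagon remains. *)
exists id; split => //; first by exists id.
have codomI (x : 'I_3) : x \in codom (id : 'I_3 -> 'I_3).
  by apply/codomP; exists x.
have exI (x z : 'I_3) : [exists t : 'I_3, (t != z) && (x == t)] = (x != z).
  by apply/existsP/idP => [[t /andP[tz /eqP->]]|xz] //; exists x; rewrite xz eqxx.
by case=> [[x|z]|z] [[y|w]|w] //=; rewrite ?codomI ?andbF ?exI // eq_sym.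
Qed.

(** * Edge sets of paths and cycles *)

Section Edges.

Variable V : finType.
Implicit Types (x y : V) (s t : seq V).

Fixpoint path_edges x s : {set {set V}} :=
  if s is y :: s' then [set x; y] |: path_edges y s' else set0.

Lemma path_edges_cat x s t :
  path_edges x (s ++ t) = path_edges x s :|: path_edges (last x s) t.
Proof. by elim: s x => [|y s IH] x /=; rewrite ?set0U // IH setUA. Qed.

Lemma path_edges_sub x s (E : {set V}) :
  E \in path_edges x s -> E \subset x :: s.
Proof.
elim: s x => [|y s IH] x /=; first by rewrite inE.
rewrite !inE => /predU1P[->|/IH/subsetP sE].
  by apply/subsetP => z; rewrite !inE orbA => ->.
by apply/subsetP => z /sE zs; rewrite inE zs orbT.
Qed.

(** The first edge is the only one containing [x], so the edge set determines the second vertex.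
    Removing this edge from both sides leaves the tails. *)
Lemma path_edges_inj x s t :
  uniq (x :: s) -> uniq (x :: t) -> path_edges x s = path_edges x t -> s = t.
Proof.
elim: s t x => [|y s IH] [|z t] x //.
- by move=> _ _ /setP/(_ [set x; z]); rewrite !inE eqxx.
- by move=> _ _ /setP/(_ [set x; y]); rewrite !inE eqxx.
move=> /andP[xs us] /andP[xt ut] /= E.
have notin w q : x \notin w :: q -> ([set x; y] \in path_edges w q) = false.
  move=> xwq; apply/negP => /path_edges_sub/subsetP/(_ x).
  by rewrite !inE eqxx -in_cons (negbTE xwq) => /(_ isT).
have notin' w q : x \notin w :: q -> ([set x; z] \in path_edges w q) = false.
  move=> xwq; apply/negP => /path_edges_sub/subsetP/(_ x).
  by rewrite !inE eqxx -in_cons (negbTE xwq) => /(_ isT).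
have yz : y = z.
  move/setP/(_ [set x; y]): (E).
  rewrite !inE eqxx (notin z t) // orbF => /esym/eqP/setP/(_ y).
  rewrite !inE eqxx orbT => /esym/orP[/eqP yx|/eqP //].
  by rewrite -yx mem_head in xs.
subst z; congr cons; apply: (IH _ y) => //.
apply/setP => F; case: (F =P [set x; y]) => [->|/eqP FN].
  by rewrite !notin.
by move/setP/(_ F): E; rewrite !inE (negbTE FN).
Qed.

(** An arbitrary [f] replaces [next], since dropping the head of a cycle changes its [next] function
    and would block the induction. *)
Lemma next_path_edges (f : V -> V) x s y :
  (forall i, i <= size s -> f (nth x (x :: s) i) = nth x (rcons s y) i) ->
  [set [set u; f u] | u in x :: s] = path_edges x (rcons s y).
Proof.
elim: s x => [|z s IH] x fE.
  have := fE 0 isT; rewrite /= => fx.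
  apply/setP => E; rewrite !inE orbF; apply/imsetP/eqP => [[u]|->].
    by rewrite inE => /eqP-> ->; rewrite fx.
  by exists x; rewrite ?mem_head ?fx.
rewrite /= -IH => [|i si]; last first.
  rewrite [nth z (z :: s) i](set_nth_default x) // (fE i.+1 si).
  by rewrite /= [nth z _ _](set_nth_default x) // size_rcons ltnS.
have := fE 0 isT; rewrite /= => fx.
apply/setP => E; rewrite in_setU1; apply/imsetP/predU1P.
  case=> u; rewrite inE => /predU1P[-> ->|us ->]; first by rewrite fx; left.
  by right; apply: imset_f.
case=> [->|/imsetP[u us ->]]; first by exists x; rewrite ?mem_head ?fx.
by exists u => //; rewrite inE us orbT.
Qed.

Lemma cycle_edgesE x s :
  uniq (x :: s) -> cycle_edges (x :: s) = path_edges x (rcons s x).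
Proof.
move=> us; apply: (@next_path_edges (next (x :: s))) => i si.
rewrite next_nth mem_nth // index_uniq // nth_rcons.
by case: ltngtP si => // ->; rewrite nth_default.
Qed.

Lemma cycle_edges_rot n s : uniq s -> cycle_edges (rot n s) = cycle_edges s.
Proof.
move=> us; rewrite /cycle_edges.
under eq_imset => x do rewrite (next_rot n us).
apply/setP => E; apply/imsetP/imsetP => -[x xs ->]; exists x => //.
  by rewrite -(mem_rot n).
by rewrite mem_rot.
Qed.

Lemma cycle_edges_rev s : uniq s -> cycle_edges (rev s) = cycle_edges s.
Proof.
move=> us; apply/setP => E; apply/imsetP/imsetP => -[x xs ->].
  rewrite mem_rev in xs.
  exists (prev s x); first by rewrite mem_prev.
  by rewrite next_rev // next_prev // setUC.
exists (next s x); first by rewrite mem_rev mem_next.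
by rewrite next_rev // prev_next // setUC.
Qed.

Lemma path_edges_last x s E :
  E \in path_edges x s -> exists2 y, y \in s & y \in E.
Proof.
elim: s x => [|y s IH] x /=; first by rewrite inE.
rewrite in_setU1 => /predU1P[->|/IH[z zs zE]].
  by exists y; rewrite ?mem_head ?set22.
by exists z; rewrite // inE zs orbT.
Qed.

(** The list [x :: rev s] is a rotation of [rev (x :: s)]: the cycle is read backwards from the same
    starting vertex. *)
Lemma cycle_edges_rev_tail x s :
  uniq (x :: s) -> cycle_edges (x :: rev s) = cycle_edges (x :: s).
Proof.
move=> us; rewrite -(cycle_edges_rev us) rev_cons -cats1.
by rewrite -[RHS](cycle_edges_rot (size (rev s))) ?rot_size_cat // cats1 -rev_cons rev_uniq.
Qed.

Lemma mem_cover_cycle_edges s x : (x \in cover (cycle_edges s)) = (x \in s).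
Proof.
apply/bigcupP/idP => [[E /imsetP[u us ->]]|xs].
  by rewrite !inE => /orP[]/eqP-> //; rewrite mem_next.
by exists [set x; next s x]; [apply/imsetP; exists x | rewrite set21].
Qed.

End Edges.

(** * Transport of cycles along embeddings *)

Section Embedding.

Variables (V W : finType) (e : rel V) (e' : rel W) (f : V -> W).
Hypotheses (f_inj : injective f) (f_mono : {mono f : u v / e u v >-> e' u v}).

Definition map_edges (E : {set {set V}}) : {set {set W}} :=
  [set f @: (F : {set V}) | F in E].

Lemma map_edges_inj : injective map_edges.
Proof. exact/imset_inj/imset_inj. Qed.

Lemma mem_map_edges (F : {set V}) E : (f @: F \in map_edges E) = (F \in E).
Proof. exact/mem_imset/imset_inj. Qed.

Lemma path_edges_map x s :
  path_edges (f x) (map f s) = map_edges (path_edges x s).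
Proof.
rewrite /map_edges; elim: s x => [|y s IH] x /=; first by rewrite imset0.
by rewrite IH imsetU1 imsetU1 imset_set1.
Qed.

Lemma cycle_edges_map s :
  uniq s -> cycle_edges (map f s) = map_edges (cycle_edges s).
Proof.
have nil0 (T : finType) : cycle_edges ([::] : seq T) = set0.
  by apply/setP => E; rewrite inE; apply/imsetP => -[].
case: s => [|x s] us; first by rewrite /map_edges !nil0 imset0.
rewrite map_cons (cycle_edgesE us) cycle_edgesE -?path_edges_map ?map_rcons //.
by rewrite -map_cons map_inj_uniq.
Qed.

Lemma map_simple_cycle E :
  E \in simple_cycles e -> map_edges E \in simple_cycles e'.
Proof.
case/simple_cyclesP => c [c2 /andP[ec uc] ->]; apply/simple_cyclesP.
exists (map f c); rewrite size_map cycle_edges_map //; split=> //.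
by rewrite /ucycle (mono_cycle f_mono) ec map_inj_uniq.
Qed.

Lemma leq_card_simple_cycles : #|simple_cycles e| <= #|simple_cycles e'|.
Proof.
rewrite -(card_imset _ map_edges_inj); apply: subset_leq_card.
by apply/subsetP => _ /imsetP[E Ec ->]; apply: map_simple_cycle.
Qed.

End Embedding.

(** * Counting simple paths as plain sequences, and invariance under isomorphism *)

Definition is_simple_path (V : finType) (e : rel V) (x y : V) (s : seq V) : bool :=
  [&& path e x s, uniq (x :: s) & last x s == y].

Lemma card_simple_paths (V : finType) (e : rel V) (x y : V) (L : seq (seq V)) :
  uniq L -> (forall s, (s \in L) = is_simple_path e x y s) ->
  #|simple_paths e x y| = size L.
Proof.
move=> uL LE; rewrite cardE -(size_map (@seq_of V)); apply/perm_size.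
apply: uniq_perm => // [|s].
  by rewrite map_inj_uniq ?enum_uniq //; apply: seq_of_inj.
rewrite LE; apply/mapP/(simple_pathsP e x y s) => -[p].
  by rewrite mem_enum => ps ->; exists p.
by move=> ps <-; exists p; rewrite ?mem_enum.
Qed.

Definition path_list (V : finType) (e : rel V) (x y : V) : seq (seq V) :=
  [seq seq_of p | p in simple_paths e x y].

Lemma uniq_path_list (V : finType) (e : rel V) (x y : V) : uniq (path_list e x y).
Proof. by rewrite map_inj_uniq ?enum_uniq //; apply: seq_of_inj. Qed.

Lemma size_path_list (V : finType) (e : rel V) (x y : V) :
  size (path_list e x y) = #|simple_paths e x y|.
Proof. exact: size_image. Qed.

Lemma mem_path_list (V : finType) (e : rel V) (x y : V) s :
  (s \in path_list e x y) = is_simple_path e x y s.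
Proof. by apply/imageP/(simple_pathsP e x y s) => -[p ps]; exists p. Qed.

Lemma leq_card_simple_paths (V W : finType) (e : rel V) (e' : rel W) (f : V -> W) x y :
  injective f -> {mono f : u v / e u v >-> e' u v} ->
  #|simple_paths e x y| <= #|simple_paths e' (f x) (f y)|.
Proof.
move=> f_inj f_mono.
rewrite -!size_path_list -(size_map (map f)); apply: uniq_leq_size.
  by rewrite map_inj_uniq ?uniq_path_list //; apply: inj_map.
move=> _ /mapP[s + ->]; rewrite !mem_path_list /is_simple_path -map_cons.
by rewrite (mono_path f_mono) map_inj_uniq // last_map inj_eq.
Qed.

(** Each equality is a pair of inequalities, one from the isomorphism and one from its inverse, both
    being embeddings. *)
Lemma tgraph_iso_card (G H : tgraph) (x y : 'I_3) :
  tgraph_iso G H ->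
  #|simple_cycles (@adj G)| = #|simple_cycles (@adj H)| /\
  #|simple_paths (@adj G) (outer G x) (outer G y)|
    = #|simple_paths (@adj H) (outer H x) (outer H y)|.
Proof.
case=> f [[g fK gK] fa fo _].
have ga : {mono g : u v / adj u v} by move=> u v; rewrite -fa !gK.
have go t : g (outer H t) = outer G t by rewrite -fo fK.
have f_inj := can_inj fK; have g_inj := can_inj gK.
split; apply/eqP; rewrite eqn_leq.
  by rewrite (leq_card_simple_cycles f_inj fa) (leq_card_simple_cycles g_inj ga).
rewrite -!fo leq_card_simple_paths //= -{2}[outer G x]fK -{2}[outer G y]fK.
exact: leq_card_simple_paths.
Qed.

(** * The three letters, and auxiliary facts on duplicate-free lists *)

Lemma letterP (x y z t : 'I_3) :
  x != y -> x != z -> y != z -> [\/ t = x, t = y | t = z].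
Proof.
move=> xy xz yz.
suff /or3P[/eqP-> |/eqP-> |/eqP->] : [|| t == x, t == y | t == z].
- by constructor 1.
- by constructor 2.
- by constructor 3.
by move: x y z t xy xz yz;
  do 4!case=> [[|[|[|//]]] ?].
Qed.

Lemma ordS_letters (t : 'I_3) :
  [/\ t != ordS t, t != ordS (ordS t) & ordS t != ordS (ordS t)].
Proof. by split; case: t => [[|[|[|//]]] ?]; rewrite -val_eqE. Qed.

Lemma letters_cyclic (x y z : 'I_3) : x != y -> x != z -> y != z ->
  (y = ordS x /\ z = ordS (ordS x)) \/ (z = ordS x /\ y = ordS (ordS x)).
Proof.
move=> xy xz yz.
suff : (y == ordS x) && (z == ordS (ordS x)) || (z == ordS x) && (y == ordS (ordS x)).
  by case/orP => /andP[/eqP-> /eqP->]; [left | right].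
by move: x y z xy xz yz; do 3!case=> [[|[|[|//]]] ?] //=.
Qed.

Lemma third_letter (x y : 'I_3) : x != y -> exists2 z, x != z & y != z.
Proof.
move=> xy; have [xSx xSSx SxSSx] := ordS_letters x.
have [yE|yE|yE] := letterP y xSx xSSx SxSSx; first by rewrite yE eqxx in xy.
  by exists (ordS (ordS x)); rewrite ?yE.
by exists (ordS x); rewrite // yE eq_sym.
Qed.

(** Since [k] reads off from a value the key of its index, families with different indices are
    disjoint, and injectivity is only needed within one family. *)
Lemma uniq_allpairs_key (I T U K : eqType) (J : seq I) (L : I -> seq T)
    (F : I -> T -> U) (key : I -> K) (k : U -> K) :
  uniq (map key J) -> (forall j p, k (F j p) = key j) ->
  {in J, forall j, uniq (L j)} ->
  {in J, forall j, {in L j &, injective (F j)}} ->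
  uniq [seq F j p | j <- J, p <- L j].
Proof.
move=> uJ kF uL F_inj; apply: allpairs_uniq_dep => //; first exact: map_uniq uJ.
move=> _ _ /allpairsPdep[i [p [iJ pL ->]]] /allpairsPdep[j [q [jJ qL ->]]] /= E.
have keyij : key i = key j by rewrite -(kF i p) -(kF j q) E.
have ij : i = j.
  rewrite -(nth_index i iJ) -(nth_index i jJ); congr nth.
  apply/eqP; rewrite -(@nth_uniq _ (key i) (map key J)) ?size_map ?index_mem //.
  by rewrite !(nth_map i) ?index_mem // !nth_index // keyij.
by subst j; congr Tagged; apply: F_inj E.
Qed.

Lemma uniq_last_nil (T : eqType) (x : T) s : uniq (x :: s) -> last x s = x -> s = [::].
Proof. by case: s => //= y s /andP[+ _] E; rewrite -{1}E mem_last. Qed.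

Lemma uniq_reenter (T : eqType) (a b : T) p q r :
  last a p = b -> uniq (r ++ a :: p ++ b :: q) = false.
Proof.
move=> <-; apply/negbTE; rewrite cat_uniq negb_and; apply/orP; right.
by rewrite negb_and -cat_cons cat_uniq /= mem_last andbF orbT.
Qed.

Lemma inl_eqE (T U : eqType) (a b : T) : (inl a == inl b :> T + U) = (a == b).
Proof. by []. Qed.
Lemma inr_eqE (T U : eqType) (a b : U) : (inr a == inr b :> T + U) = (a == b).
Proof. by []. Qed.
Lemma inl_inrE (T U : eqType) (a : T) (b : U) : (inl a == inr b :> T + U) = false.
Proof. by []. Qed.
Lemma inr_inlE (T U : eqType) (a : T) (b : U) : (inr b == inl a :> T + U) = false.
Proof. by []. Qed.
Definition inl_inr_eqE := (inl_eqE, inr_eqE, inl_inrE, inr_inlE).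

(** * Walks in a wrapped graph, split into hexagon and inner parts *)

Section Wrap.

Variable G : tgraph.
Local Notation V := (vtx G).
Local Notation e := (@adj G).
Local Notation W := (hexagon + vtx G)%type.
Local Notation e' := (@wrap_adj G).
Local Notation A t := (inl (inl t : hexagon) : W).
Local Notation P t := (inl (inr t : hexagon) : W).
Local Notation inner_seq p := (map (inr : V -> W) p).
Local Notation hex_seq h := (map (inl : hexagon -> W) h).

Definition hex_part (s : seq W) : seq hexagon :=
  pmap (fun u => if u is inl h then Some h else None) s.

Definition inner_part (s : seq W) : seq V :=
  pmap (fun u => if u is inr v then Some v else None) s.

Lemma hex_part_inr p : hex_part (inner_seq p) = [::].
Proof. by elim: p. Qed.

Lemma hex_part_inl h : hex_part (map inl h) = h.
Proof. by elim: h => //= x h {2}<-. Qed.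

Lemma inner_part_inr p : inner_part (inner_seq p) = p.
Proof. by elim: p => //= x p {2}<-. Qed.

Lemma inner_part_inl h : inner_part (map inl h) = [::].
Proof. by elim: h. Qed.

Lemma hex_part_cat s t : hex_part (s ++ t) = hex_part s ++ hex_part t.
Proof. exact: pmap_cat. Qed.

Lemma inner_part_cat s t : inner_part (s ++ t) = inner_part s ++ inner_part t.
Proof. exact: pmap_cat. Qed.

Lemma hex_part_cons u s :
  hex_part (u :: s) = if u is inl h then h :: hex_part s else hex_part s.
Proof. by case: u. Qed.

Lemma inner_part_cons u s :
  inner_part (u :: s) = if u is inr v then v :: inner_part s else inner_part s.
Proof. by case: u. Qed.

Lemma mem_hex_part h s : (h \in hex_part s) = (inl h \in s).
Proof. by elim: s => [|[k|v] s IH] //=; rewrite !inE IH. Qed.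

Lemma mem_inner_part v s : (v \in inner_part s) = (inr v \in s).
Proof. by elim: s => [|[k|u] s IH] //=; rewrite !inE IH. Qed.

(** Hexagon and inner vertices never coincide, so repetitions can be sought in each part separately,
    however the two are interleaved. *)
Lemma uniq_parts s : uniq s = uniq (hex_part s) && uniq (inner_part s).
Proof.
elim: s => [|[h|v] s IH] //=; rewrite IH ?mem_hex_part ?mem_inner_part.
  by rewrite andbA.
by rewrite andbCA.
Qed.

Definition partsE := (hex_part_cat, inner_part_cat, hex_part_inr, hex_part_inl,
  inner_part_inr, inner_part_inl, hex_part_cons, inner_part_cons).

Lemma path_inr u p : path e' (inr u) (inner_seq p) = path e u p.
Proof. exact: mono_path. Qed.

Lemma detour_path z w p s :
  path e' (P z) (inner_seq (outer G z :: p) ++ P w :: s) =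
    [&& path e (outer G z) p, last (outer G z) p == outer G w
      & path e' (P w) s].
Proof. by rewrite /= eqxx cat_path path_inr last_map. Qed.

(** A walk that ends in the hexagon must leave the inner copy. It is cut at its first hexagon
    vertex, which can only be the end [P w] of a spoke. *)
Lemma exit_inner u s h :
  path e' (inr u) s -> last (inr u) s = inl h ->
  exists p w s', [/\ s = inner_seq p ++ P w :: s', path e u p,
                     last u p = outer G w & path e' (P w) s'].
Proof.
elim: s u => [|[[t|w]|v] s IH] u //=.
  by move=> /andP[/eqP uw ps] _; exists [::], w, s.
case/andP=> uv /IH{}IH /IH[p [w [s' [-> pp lp ps']]]].
by exists (v :: p), w, s'; rewrite /= uv.
Qed.

Lemma from_A t s :
  path e' (A t) s ->
  s = [::] \/ exists j s', [/\ s = P j :: s', j != t & path e' (P j) s'].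
Proof.
case: s => [|[[j|j]|v] s] //=; first by left.
by case/andP=> tj ps; right; exists j, s; rewrite eq_sym.
Qed.

Lemma from_P z s h :
  path e' (P z) s -> last (P z) s = inl h ->
  [\/ s = [::],
      exists t s', [/\ s = A t :: s', t != z & path e' (A t) s']
    | exists p w s', [/\ s = inner_seq (outer G z :: p) ++ P w :: s',
                         path e (outer G z) p, last (outer G z) p = outer G w
                       & path e' (P w) s']].
Proof.
case: s => [|[[t|j]|v] s] //=; first by constructor 1.
  by case/andP=> tz ps _; constructor 2; exists t, s; rewrite tz.
case/andP=> /eqP-> /exit_inner/[apply] -[p [w [s' [-> pp lp ps']]]].
by constructor 3; exists p, w, s'.
Qed.

Lemma path_inl h s : path e' (inl h) (map (inl : hexagon -> W) s) = path hexagon_adj h s.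
Proof. by apply: mono_path => -[t|t] k. Qed.

(** The only inner neighbour of [P w] is [outer G w], so turning back into the copy from [P w]
    repeats the vertex just left. *)
Lemma no_reentry (t : seq W) u w p q r :
  last (outer G u) p = outer G w ->
  uniq (t ++ inner_seq (outer G u :: p) ++ P w :: inner_seq (outer G w :: q) ++ r)
  = false.
Proof.
move=> lp; apply/negbTE; rewrite uniq_parts negb_and !inner_part_cat inner_part_cons.
rewrite inner_part_cat !inner_part_inr.
by rewrite [X in _ || ~~ X](uniq_reenter _ _ lp) orbT.
Qed.

Lemma last_hex_nil h (s : seq W) :
  h \notin hex_part s -> last (inl h) s == inl h -> s = [::].
Proof.
case: s => // u s; rewrite mem_hex_part /= => N /eqP E.
by rewrite -[inl h]E mem_last in N.
Qed.

Definition detour (pre : seq hexagon) (u : 'I_3) (p : seq V) (suf : seq hexagon) :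
    seq W :=
  hex_seq pre ++ inner_seq (outer G u :: p) ++ hex_seq suf.

Lemma uniq_detour h pre u p suf :
  uniq (inl h :: detour pre u p suf) = uniq (h :: pre ++ suf) && uniq (outer G u :: p).
Proof. by rewrite uniq_parts /detour !partsE cats0. Qed.

Lemma detour_simple_path x y pre u w p suf :
  path hexagon_adj x (rcons pre (inr u)) -> path hexagon_adj (inr w) suf ->
  uniq (x :: rcons pre (inr u) ++ inr w :: suf) -> last (inr w) suf = y ->
  is_simple_path e (outer G u) (outer G w) p ->
  is_simple_path e' (inl x) (inl y) (detour (rcons pre (inr u)) u p (inr w :: suf)).
Proof.
move=> ppre psuf us ls /and3P[pp up lp]; apply/and3P; split.
- rewrite /detour cat_path path_inl ppre last_map last_rcons.
  by rewrite detour_path pp lp path_inl.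
- by rewrite uniq_detour us.
- by rewrite /detour !last_cat /= last_map ls.
Qed.

(** Here the hexagon contributes the arc from [P z] to [P y] through the single outer vertex
    [A x]. *)
Definition short_cycle x y z p : seq W :=
  inl (inl x) :: detour [:: inr y] y p [:: inr z].

(** Here the hexagon contributes the arc from [P z] to [P x] through [A x], [P y] and [A z], which
    avoids [A y]. *)
Definition long_cycle x y z p : seq W :=
  inl (inl x) :: detour [:: inr y; inl z; inr x] x p [:: inr z].

Definition hexagon_cycle x y z : seq W := [:: A x; P y; A z; P x; A y; P z].

(** * Classification of the simple paths between two outer vertices *)

Section ThreeLetters.

Variables x y z : 'I_3.
Hypotheses (xy : x != y) (xz : x != z) (yz : y != z).

Let neqE := (negbTE xy, negbTE xz, negbTE yz,
  eq_sym y x, eq_sym z x, eq_sym z y).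

(** The code [(pre, u, w, suf)] stands for the paths that run through [pre] in
    the hexagon, enter the inner copy at [outer G u], leave it at [outer G w]
    and continue along [suf]. *)
Definition detour_code : eqType :=
  (seq hexagon * 'I_3 * 'I_3 * seq hexagon)%type.

Definition detours : seq detour_code :=
  [:: ([:: inr z], z, x, [:: inr x; inl y]);
      ([:: inr z], z, y, [:: inr y; inl z; inr x; inl y]);
      ([:: inr y], y, z, [:: inr z; inl y]);
      ([:: inr y], y, x, [:: inr x; inl y]);
      ([:: inr y; inl z; inr x], x, z, [:: inr z; inl y])].

Ltac parts :=
  rewrite uniq_parts ?partsE /= ?cats0 ?inE ?inl_inr_eqE ?neqE ?eqxx ?andbF ?orbT //=.

(* Once the three letters have been told apart, a dead branch of the search
   either repeats a hexagon vertex, or stops at the wrong vertex, or re-enters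
   the inner copy at the vertex through which it was just left. *)
Ltac prune := try solve [exfalso;
  match goal with
  | H : is_true (?a != ?a) |- _ => by rewrite eqxx in H
  | U : is_true (uniq _) |- _ => solve [move: U; parts]
  | L : is_true (last _ _ == _) |- _ =>
      solve [move: L; rewrite /= ?last_cat /= ?inl_inr_eqE ?neqE //=]
  | U : is_true (uniq (?a :: ?b :: map _ (outer G ?u :: ?p) ++ _)),
    lp : last (outer G ?u) ?p = outer G _ |- _ =>
      discriminate (etrans (esym U) (@no_reentry [:: a; b] _ _ _ _ _ lp))
  | U : is_true (uniq (?a :: ?b :: ?c :: ?d :: map _ (outer G ?u :: ?p) ++ _)),
    lp : last (outer G ?u) ?p = outer G _ |- _ =>
      discriminate (etrans (esym U) (@no_reentry [:: a; b; c; d] _ _ _ _ _ lp))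
  end].

Ltac at_end :=
  match goal with
  | U : is_true (uniq _), L : is_true (last _ _ == inl ?h) |- _ =>
    rewrite /= ?last_cat /= in L;
    match type of L with is_true (last _ ?s == _) =>
    have /last_hex_nil/(_ L) ? : h \notin hex_part s;
    [let N := fresh in apply/negP => N; move: U;
       rewrite uniq_parts ?partsE /= ?inE ?N ?orbT ?andbF; discriminate
    | subst s] end
  end.

Ltac split_letter L3 t := case: (L3 t) => ?; subst t; prune.

(* Exhaustive search for the simple paths of the wrapped graph with prescribed
   end, driven by [from_A] and [from_P]; every surviving goal is one pattern. *)
Ltac explore L3 :=
  match goal with
  | L : is_true (last _ _ == inl ?h), p : is_true (path _ (inl ?h) ?s) |- _ =>
    is_var s; at_end
  | p : is_true (path _ (inl (inl _)) ?s) |- _ =>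
    is_var s;
    let j := fresh "j" in let s' := fresh "s" in
    have [?|[j [s' [? ? ?]]]] := from_A p; subst s; clear p; prune;
    split_letter L3 j; explore L3
  | L : is_true (last _ _ == _), p : is_true (path _ (inl (inr _)) ?s) |- _ =>
    is_var s; rewrite /= ?last_cat /= in L;
    let j := fresh "t" in let w := fresh "w" in
    let s' := fresh "s" in let q := fresh "q" in
    have [?|[j [s' [? ? ?]]]|[q [w [s' [? ? ? ?]]]]] := from_P p (eqP L);
    subst s; clear p;
    [ prune | prune; split_letter L3 j; explore L3
    | prune; split_letter L3 w; explore L3 ]
  end.

Definition path_shape (s : seq W) : Prop :=
  [\/ s = [:: P z; A y], s = [:: P y; A z; P x; A y]
    | exists j : detour_code, exists p, [/\ j \in detours,
        is_simple_path e (outer G j.1.1.2) (outer G j.1.2) p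
        & s = detour j.1.1.1 j.1.1.2 p j.2]].

Lemma simple_path_shape s : is_simple_path e' (A x) (A y) s -> path_shape s.
Proof.
have L3 t := letterP t xy xz yz.
move=> /and3P[ps U L]; rewrite /path_shape.
explore L3; try solve [by constructor 1 | by constructor 2].
all: constructor 3.
all: match goal with
  | U : is_true (uniq _), pq : is_true (path _ (outer G ?u) ?q),
    lq : last (outer G ?u) ?q = outer G ?w |- _ =>
    have pE : is_simple_path e (outer G u) (outer G w) q by
      apply/and3P; split; [exact: pq | | by apply/eqP; exact: lq];
      move: U; rewrite uniq_parts ?partsE /= ?cats0 => /andP[_]
  end.
(* The surviving branches match the five codes one to one, but arrive in the order of the search and
   not of [detours]. *)
- by exists ([:: inr y; inl z; inr x], x, z, [:: inr z; inl y]), q; split=> //;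
  do 4!apply: mem_behead; exact: mem_head.
- by exists ([:: inr y], y, x, [:: inr x; inl y]), q; split=> //;
  do 3!apply: mem_behead; exact: mem_head.
- by exists ([:: inr y], y, z, [:: inr z; inl y]), q; split=> //;
  do 2!apply: mem_behead; exact: mem_head.
- by exists ([:: inr z], z, x, [:: inr x; inl y]), q; split=> //;
  exact: mem_head.
- by exists ([:: inr z], z, y, [:: inr y; inl z; inr x; inl y]), q; split=> //;
  apply: mem_behead; exact: mem_head.
Qed.

Lemma path_shape_simple s : path_shape s -> is_simple_path e' (A x) (A y) s.
Proof.
case=> [->|->|[j [p [jd pp ->]]]].
- by rewrite /is_simple_path /= ?inE ?inl_inr_eqE ?neqE eqxx.
- by rewrite /is_simple_path /= ?inE ?inl_inr_eqE ?neqE eqxx.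
move: jd; rewrite !inE => /or4P[/eqP E|/eqP E|/eqP E|/orP[]/eqP E]; subst j.
- by apply: (@detour_simple_path _ _ [::]) => //=; rewrite ?inE ?inl_inr_eqE ?neqE.
- by apply: (@detour_simple_path _ _ [::]) => //=; rewrite ?inE ?inl_inr_eqE ?neqE.
- by apply: (@detour_simple_path _ _ [::]) => //=; rewrite ?inE ?inl_inr_eqE ?neqE.
- by apply: (@detour_simple_path _ _ [::]) => //=; rewrite ?inE ?inl_inr_eqE ?neqE.
- by apply: (@detour_simple_path _ _ [:: inr y; inl z]) => //=;
  rewrite ?inE ?inl_inr_eqE ?neqE.
Qed.

Lemma detour_inj pre u suf : injective (detour pre u ^~ suf).
Proof.
move=> p q /(congr1 inner_part); rewrite /detour !partsE !cats0.
by case.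
Qed.

Lemma hex_part_detour pre u p suf : hex_part (detour pre u p suf) = pre ++ suf.
Proof. by rewrite /detour !partsE. Qed.

Lemma card_simple_paths_wrap_third N :
  (forall u w, u != w -> #|simple_paths e (outer G u) (outer G w)| = N) ->
  #|simple_paths e' (A x) (A y)| = 5 * N + 2.
Proof.
move=> cardN.
pose L (j : detour_code) := path_list e (outer G j.1.1.2) (outer G j.1.2).
pose F (j : detour_code) p := detour j.1.1.1 j.1.1.2 p j.2.
pose D := [seq F j p | j <- detours, p <- L j].
have inner_part_D s : s \in D -> inner_part s != [::].
  by case/allpairsPdep => j [p [_ _ ->]]; rewrite /F /detour !partsE.
have nD h : map (inl : hexagon -> W) h \notin D.
  by apply/negP => /inner_part_D; rewrite inner_part_inl.
have -> : 5 * N + 2 = size [:: [:: P z; A y], [:: P y; A z; P x; A y] & D].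
  rewrite /= size_allpairs_dep /= !size_path_list !cardN ?neqE //.
  by rewrite addn0 !mulSn mul0n addn0 addn2.
apply: card_simple_paths => [|s].
  rewrite !cons_uniq !in_cons !negb_or.
  rewrite (nD [:: inr z; inl y]) (nD [:: inr y; inl z; inr x; inl y]).
  rewrite eqseq_cons !inl_inr_eqE !neqE /=.
  (* The five codes have pairwise different hexagon parts, so the hexagon part of a path reveals its
     code. *)
  pose key (j : detour_code) := j.1.1.1 ++ j.2.
  apply: (@uniq_allpairs_key _ _ _ _ detours L F key hex_part).
  - by rewrite /= !inE /key /= ?eqseq_cons ?inl_inr_eqE ?neqE ?andbF.
  - by move=> j p; apply: hex_part_detour.
  - by move=> j _; apply: uniq_path_list.
  - by move=> j _ p q _ _; apply: detour_inj.
apply/idP/idP => [|/simple_path_shape].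
  rewrite !in_cons => /or3P[/eqP->|/eqP->|/allpairsPdep[j [p [jd]]]].
  - by apply: path_shape_simple; constructor 1.
  - by apply: path_shape_simple; constructor 2.
  rewrite mem_path_list => pp ->.
  by apply: path_shape_simple; constructor 3; exists j, p.
rewrite !in_cons => -[->|->|[j [p [jd pp ->]]]]; rewrite ?eqxx ?orbT //.
apply/or3P; constructor 3; apply/allpairsPdep; exists j, p.
by rewrite mem_path_list.
Qed.

(** * Classification of the simple cycles *)

(** The cycle is read from [A x], with [P y] next and [P z] last. In the fourth shape the long arc
    begins at [A y], two places before [A x], whence the rotation. *)
Definition cycle_shape (c : seq W) : Prop :=
  [\/ c = hexagon_cycle x y z,
      exists2 p, is_simple_path e (outer G y) (outer G z) p & c = short_cycle x y z p,
      exists2 p, is_simple_path e (outer G x) (outer G z) p & c = long_cycle x y z p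
    | exists2 p, is_simple_path e (outer G y) (outer G x) p
        & c = rot 2 (long_cycle y z x p)].

Lemma simple_cycle_shape s :
  path e' (P y) s -> uniq (A x :: P y :: s) -> last (P y) s == P z ->
  cycle_shape (A x :: P y :: s).
Proof.
have L3 t := letterP t xy xz yz.
move=> ps U L; rewrite /cycle_shape.
explore L3; try solve [by constructor 1].
all: match goal with
  | U : is_true (uniq _), pq : is_true (path _ (outer G ?u) ?q),
    lq : last (outer G ?u) ?q = outer G ?w |- _ =>
    have pE : is_simple_path e (outer G u) (outer G w) q by
      apply/and3P; split; [exact: pq | | by apply/eqP; exact: lq];
      move: U; rewrite uniq_parts ?partsE /= ?cats0 => /andP[_]
  end.
- by constructor 3; exists q.
- constructor 4; exists q => //.
  pose s := A x :: P y :: inner_seq (outer G y :: q) ++ [:: P x].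
  by rewrite (@rot_size_cat _ [:: A y; P z] s) /= -catA.
- by constructor 2; exists q.
Qed.

End ThreeLetters.

Hypothesis adj_sym : symmetric e.

(** A subdividing vertex [P z] has only one inner neighbour, while its two neighbours on a cycle are
    distinct; hence one of them is an outer vertex. *)
Lemma mem_outer_hexagon c t : ucycle e' c -> 2 < size c -> inl t \in c ->
  exists j, A j \in c.
Proof.
move=> cc c2 tc; case: t tc => [t|z] tc; first by exists t.
have /rot_to[i s cE] := tc.
have : ucycle e' (rot i c) by rewrite rot_ucycle.
have : 2 < size (rot i c) by rewrite size_rot.
have mem_c u : u \in rot i c -> u \in c by rewrite mem_rot.
rewrite {}cE in mem_c *; case: s mem_c => // u s; case/lastP: s => // s v mem_c _.
case/andP; rewrite /= !rcons_path last_rcons => /and3P[zu _ vz] /and3P[_ + _].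
case: u mem_c zu => [[j|//]|u] mem_c zu.
  by exists j; apply: mem_c; rewrite !inE eqxx ?orbT.
case: v mem_c vz => [[j|//]|v] mem_c vz.
  by exists j; apply: mem_c; rewrite !inE mem_rcons mem_head !orbT.
by rewrite mem_rcons (eqP zu) (eqP vz) mem_head.
Qed.

Lemma hexagon_free c : (forall t, inl t \notin c) -> c = inner_seq (inner_part c).
Proof.
elim: c => //= -[h|v] c IH hc; first by have := hc h; rewrite mem_head.
by congr cons; apply: IH => t; apply: contra (hc t); rewrite inE => ->; rewrite orbT.
Qed.

(** A cycle that meets the hexagon can be rotated to start at some [A x]. Both neighbours of [A x]
    on it are then subdividing vertices, which name [y] and [z]. *)
Lemma cycle_edges_shape c : ucycle e' c -> 2 < size c ->
  (exists c0, [/\ ucycle e c0, 2 < size c0 & c = inner_seq c0]) \/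
  exists x y z c', [/\ x != y, x != z, y != z, cycle_edges c = cycle_edges c'
                     & cycle_shape x y z c'].
Proof.
move=> cc c2; have [/existsP[t tc]|/existsPn nc] :=
  boolP [exists t : hexagon, inl t \in c]; last first.
  left; exists (inner_part c); move/hexagon_free: nc => cE.
  rewrite cE size_map in c2; split => //.
  by move: cc; rewrite {1}cE /ucycle (@mono_cycle _ _ _ e) // map_inj_uniq // => ? ? [].
right; have [x /rot_to[i s cE]] := mem_outer_hexagon cc c2 tc.
have := cc; rewrite -(rot_ucycle i) -(cycle_edges_rot i); last by case/andP: cc.
rewrite -(size_rot i) {}cE in c2 *; case/andP => /= ps us.
have [//|[y [s' [sE yx p1]]]] := from_A ps; first by case: (s).
case: s => // u s in c2 ps us sE *; case: sE => uE s'E; subst u s'.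
case/lastP: s => // s v in c2 ps us p1 *.
move: p1; rewrite rcons_path last_rcons => /andP[p1 vx].
case: v => [[//|z]|//] in c2 ps us p1 vx *.
have yz : y != z.
  case/and3P: us => _ + _; rewrite mem_rcons inE negb_or => /andP[+ _].
  by apply: contraNneq => ->.
exists x, y, z, (A x :: P y :: rcons s (P z)); split=> //; first by rewrite eq_sym.
apply: simple_cycle_shape => //; try by rewrite eq_sym.
by rewrite last_rcons.
Qed.

(** * Reversal, and normal forms of the cycles that use two spokes *)

Lemma rev_simple_path u w p : is_simple_path e u w p ->
  exists2 p', is_simple_path e w u p' & w :: p' = rev (u :: p).
Proof.
case/and3P=> pp up /eqP lp; subst w.
exists (rev (belast u p)); last by rewrite (lastI u p) rev_rcons.
apply/and3P; split.
- by rewrite rev_path; apply: sub_path pp => a b; rewrite adj_sym.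
- by rewrite -rev_rcons -lastI rev_uniq.
- by case: p {up pp} => //= a p; rewrite rev_cons last_rcons.
Qed.

Lemma cycle_edges_short_rev x y z p : x != y -> x != z -> y != z ->
  is_simple_path e (outer G y) (outer G z) p ->
  exists2 p', is_simple_path e (outer G z) (outer G y) p'
    & cycle_edges (short_cycle x y z p) = cycle_edges (short_cycle x z y p').
Proof.
move=> xy xz yz pp; have [p' pp' E] := rev_simple_path pp; exists p' => //.
rewrite -[RHS]cycle_edges_rev_tail; last first.
  rewrite uniq_detour /= !inE !inl_inr_eqE eq_sym (negbTE yz).
  by case/and3P: pp'.
by rewrite /short_cycle /detour E map_rev !rev_cat revK -catA.
Qed.

Lemma uniq_long_cycle x y z p : x != y -> x != z -> y != z ->
  is_simple_path e (outer G x) (outer G z) p -> uniq (long_cycle x y z p).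
Proof.
move=> xy xz yz /and3P[_ up _].
have neqE := (negbTE xy, negbTE xz, negbTE yz, eq_sym y x, eq_sym z x, eq_sym z y).
by rewrite uniq_detour /= !inE !inl_inr_eqE !neqE.
Qed.

Lemma cycle_edges_long_rev x y z p : x != y -> x != z -> y != z ->
  is_simple_path e (outer G x) (outer G z) p ->
  exists2 p', is_simple_path e (outer G z) (outer G x) p'
    & cycle_edges (long_cycle x y z p) = cycle_edges (long_cycle z y x p').
Proof.
move=> xy xz yz pp; have [p' pp' E] := rev_simple_path pp; exists p' => //.
have us := uniq_long_cycle xy xz yz pp.
have us' : uniq (long_cycle z y x p').
  by apply: uniq_long_cycle pp'; rewrite // eq_sym.
(* Reading backwards from [A x] gives [long_cycle z y x p'] with its first two vertices [A z] and
   [P y] moved to the end. *)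
rewrite -(cycle_edges_rev_tail us) -(cycle_edges_rot 2 us').
by rewrite /long_cycle /detour E map_rev !rev_cat /rot /= -!catA.
Qed.

(** [(true, t)] is the arc whose only outer vertex is [t], and [(false, t)] the
    complementary arc, which misses exactly [t]; each is traversed in the cyclic
    order of the letters, the other orientation being its reversal. *)
Definition arc_cycle (j : bool * 'I_3) : seq V -> seq W :=
  let: (b, t) := j in
  if b then short_cycle t (ordS t) (ordS (ordS t))
  else long_cycle (ordS t) t (ordS (ordS t)).

(** Both arcs of index [t] join the spokes of the two other letters, so they are closed up by the
    same inner paths. *)
Definition arc_paths (j : bool * 'I_3) : seq (seq V) :=
  path_list e (outer G (ordS j.2)) (outer G (ordS (ordS j.2))).

(** If [x], [y], [z] are in cyclic order the path [p] itself serves; otherwise its reversal does. *)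
Lemma short_arc x y z p : x != y -> x != z -> y != z ->
  is_simple_path e (outer G y) (outer G z) p ->
  exists2 p', p' \in arc_paths (true, x)
    & cycle_edges (short_cycle x y z p) = cycle_edges (arc_cycle (true, x) p').
Proof.
move=> xy xz yz pp; case: (letters_cyclic xy xz yz) => -[yE zE].
  by exists p; rewrite ?mem_path_list /= -?zE -?yE.
have [p' pp' ->] := cycle_edges_short_rev xy xz yz pp.
by exists p'; rewrite ?mem_path_list /= -?zE -?yE.
Qed.

Lemma long_arc x y z p : x != y -> x != z -> y != z ->
  is_simple_path e (outer G x) (outer G z) p ->
  exists2 p', p' \in arc_paths (false, y)
    & cycle_edges (long_cycle x y z p) = cycle_edges (arc_cycle (false, y) p').
Proof.
move=> xy xz yz pp; rewrite eq_sym in xy.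
case: (letters_cyclic xy yz xz) => -[xE zE].
  by exists p; rewrite ?mem_path_list /= -?zE -?xE.
rewrite eq_sym in xy; have [p' pp' ->] := cycle_edges_long_rev xy xz yz pp.
by exists p'; rewrite ?mem_path_list /= -?zE -?xE.
Qed.

(** A common form for short and long arcs, so that the facts on [arc_cycle] below need no
    distinction between them. *)
Lemma arc_cycleE j p : exists h pre u w suf,
  [/\ arc_cycle j p = inl h :: detour (rcons pre (inr u)) u p (inr w :: suf),
      path hexagon_adj h (rcons pre (inr u)),
      path hexagon_adj (inr w) (rcons suf h),
      uniq (h :: rcons pre (inr u) ++ inr w :: suf)
    & u = ordS j.2 /\ w = ordS (ordS j.2)].
Proof.
case: j => b t; have [xy xz yz] := ordS_letters t.
have neqE := (negbTE xy, negbTE xz, negbTE yz, eq_sym (ordS t) t,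
  eq_sym (ordS (ordS t)) t, eq_sym (ordS (ordS t)) (ordS t)).
case: b.
  exists (inl t), [::], (ordS t), (ordS (ordS t)), [::]; split => //=;
  by rewrite ?inE ?inl_inr_eqE ?neqE.
exists (inl (ordS t)), [:: inr t; inl (ordS (ordS t))], (ordS t), (ordS (ordS t)), [::].
by split => //=; rewrite ?inE ?inl_inr_eqE ?neqE.
Qed.

Lemma arc_ucycle j p : p \in arc_paths j ->
  ucycle e' (arc_cycle j p) /\ 2 < size (arc_cycle j p).
Proof.
have [h [pre [u [w [suf [-> ppre psuf us [? ?]]]]]]] := arc_cycleE j p; subst u w.
rewrite mem_path_list => /and3P[pp up lp]; split; last first.
  by rewrite /= !size_cat /= !size_map size_rcons /= !addnS.
rewrite /ucycle uniq_detour; apply/andP; split; last by apply/andP; split.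
rewrite /= /detour rcons_cat rcons_cat cat_path path_inl ppre.
rewrite last_map last_rcons -map_rcons rcons_cons.
by rewrite map_cons detour_path pp lp path_inl.
Qed.

(** * Recovering the arc and the inner path from an edge set *)

Definition inner_edges (E : {set {set W}}) : {set {set V}} :=
  [set F : {set V} | (inr : V -> W) @: F \in E].

Lemma inl_imset_inr h (F : {set V}) : (inl h \in (inr : V -> W) @: F) = false.
Proof. by apply/imsetP => -[]. Qed.

(** Every edge of the cycle outside [p] has an endpoint in the hexagon, so it is not the image of a
    set of inner vertices. *)
Lemma inner_edges_detour h pre u p suf :
  uniq (inl h :: detour pre u p suf) ->
  inner_edges (cycle_edges (inl h :: detour pre u p suf)) = path_edges (outer G u) p.
Proof.
have inr_inj : injective (inr : V -> W) by move=> ? ? [].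
move=> us; apply/setP => F; rewrite inE cycle_edgesE // /detour !rcons_cat.
rewrite -map_rcons path_edges_cat last_map path_edges_cat /=.
rewrite (@path_edges_map _ _ (inr : V -> W)) last_map !in_setU in_set1 mem_map_edges //.
apply/idP/idP => [|->]; last by rewrite !orbT.
have inlN t s : ((inr : V -> W) @: F \in path_edges t (hex_seq s)) = false.
  by apply/negP => /path_edges_last[_ /mapP[k _ ->]]; rewrite inl_imset_inr.
rewrite !inlN orbF /= => /orP[/eqP/setP/(_ (inl (last h pre)))|//].
by rewrite inl_imset_inr set21.
Qed.

(** The inner edges are those of the inner path, whose starting vertex is fixed by [j];
    [path_edges_inj] then recovers the path. *)
Lemma arc_cycle_edges_inj j :
  {in arc_paths j &, injective (fun p => cycle_edges (arc_cycle j p))}.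
Proof.
move=> p q pj qj /(congr1 inner_edges).
have [/andP[_ up] _] := arc_ucycle pj; have [/andP[_ uq] _] := arc_ucycle qj.
move: up uq pj qj; rewrite !mem_path_list.
have [h [pre [u [w [suf [-> _ _ _ [uE _]]]]]]] := arc_cycleE j p.
have [h' [pre' [u' [w' [suf' [-> _ _ _ [uE' _]]]]]]] := arc_cycleE j q.
move=> up uq /and3P[_ pp _] /and3P[_ pq _].
rewrite !inner_edges_detour // uE uE'; exact: path_edges_inj.
Qed.

(** Using [cover] makes this an invariant of the edge set, whatever vertex sequence represents the
    cycle. *)
Definition outer_part (E : {set {set W}}) : {set 'I_3} :=
  [set t | A t \in cover E].

(** Together with [set0] (cycles of the inner copy) and [setT] (the hexagon),
    these are the eight subsets of ['I_3]: the set of outer vertices on a cycle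
    tells which family it belongs to. *)
Definition arc_key (j : bool * 'I_3) : {set 'I_3} :=
  if j.1 then [set j.2] else [set~ j.2].

Lemma outer_part_cycle c : outer_part (cycle_edges c) = [set t | A t \in c].
Proof. by apply/setP => t; rewrite !inE mem_cover_cycle_edges. Qed.

Lemma outer_part_arc j p : outer_part (cycle_edges (arc_cycle j p)) = arc_key j.
Proof.
case: j => b t; rewrite outer_part_cycle; apply/setP => i.
have [xy xz yz] := ordS_letters t.
rewrite !inE -mem_hex_part /arc_cycle /arc_key; case: b;
  rewrite /short_cycle /long_cycle /detour !partsE /= !inE !inl_inr_eqE ?orbF //=.
have [->|->|->] := letterP i xy xz yz;
  by rewrite ?eqxx ?orbT ?[_ == t]eq_sym ?(negbTE xy) ?(negbTE xz) ?eqxx.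
Qed.

Lemma card_arc_key j : #|arc_key j| = if j.1 then 1 else 2.
Proof.
case: j => [[] t]; first by rewrite cards1.
by rewrite cardsC1 card_ord.
Qed.

Lemma arc_key_inj : injective arc_key.
Proof.
move=> i j E; have := congr1 (fun B : {set 'I_3} => #|B|) E.
rewrite !card_arc_key; case: i j E => [[] t] [[] u] //= + _.
  by move/set1_inj => /= ->.
by move/setC_inj/set1_inj => /= ->.
Qed.

(** The right-hand side does not mention [x], [y], [z]: all six readings of the hexagon are one
    cycle. *)
Lemma cycle_edges_hexagon x y z : x != y -> x != z -> y != z ->
  cycle_edges (hexagon_cycle x y z) =
  [set [set A j.1; P j.2] | j in [pred j : 'I_3 * 'I_3 | j.1 != j.2]].
Proof.
move=> xy xz yz.
have neqE := (negbTE xy, negbTE xz, negbTE yz, eq_sym y x, eq_sym z x, eq_sym z y).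
rewrite cycle_edgesE; last by rewrite /= !inE !inl_inr_eqE !neqE.
apply/setP => E; rewrite /= !in_setU1 in_set0 orbF; apply/idP/imsetP.
  case/or4P => [|||/or3P[]] /eqP->.
  - by exists (x, y).
  - by exists (z, y); rewrite ?inE /= ?neqE // setUC.
  - by exists (z, x); rewrite ?inE /= ?neqE.
  - by exists (y, x); rewrite ?inE /= ?neqE // setUC.
  - by exists (y, z).
  - by exists (x, z); rewrite // setUC.
case=> -[i j]; rewrite inE /= => ij ->.
rewrite ![[set P _; A _]]setUC.
case: (letterP i xy xz yz) ij => ->; case: (letterP j xy xz yz) => ->;
  by rewrite ?eqxx ?orbT.
Qed.

Lemma hexagon_simple_cycle x y z : x != y -> x != z -> y != z ->
  ucycle e' (hexagon_cycle x y z).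
Proof.
move=> xy xz yz.
have neqE := (negbTE xy, negbTE xz, negbTE yz, eq_sym y x, eq_sym z x, eq_sym z y).
by rewrite /ucycle /= !inE !inl_inr_eqE !neqE.
Qed.

Theorem card_simple_cycles_wrap N :
  (forall u w, u != w -> #|simple_paths e (outer G u) (outer G w)| = N) ->
  #|simple_cycles e'| = #|simple_cycles e| + 1 + 6 * N.
Proof.
move=> cardN.
have inr_inj : injective (inr : V -> W) by move=> ? ? [].
have [xy xz yz] := ordS_letters ord0.
pose hexE := cycle_edges (hexagon_cycle ord0 (ordS ord0) (ordS (ordS ord0))).
pose inners := [seq map_edges (inr : V -> W) E | E <- enum (simple_cycles e)].
pose arcs := [seq cycle_edges (arc_cycle j p)
             | j <- enum {: bool * 'I_3}, p <- arc_paths j].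
have arc_part E : E \in arcs -> exists j, outer_part E = arc_key j.
  by case/allpairsPdep => j [p [_ _ ->]]; exists j; apply: outer_part_arc.
have hex_part_hexE : outer_part hexE = setT.
  rewrite outer_part_cycle; apply/setP => t; rewrite !inE !inl_inr_eqE /=.
  by case: (letterP t xy xz yz) => ->; rewrite eqxx ?orbT.
have inners_part E : E \in inners -> outer_part E = set0.
  case/mapP => E0; rewrite mem_enum => /simple_cyclesP[c [_ /andP[_ uc] ->]] ->.
  rewrite -cycle_edges_map // outer_part_cycle; apply/setP => t; rewrite !inE.
  by apply/mapP => -[].
have uE : uniq (inners ++ hexE :: arcs).
  (* The number of outer vertices separates the families: none for inner cycles, three for the
     hexagon, one or two for arcs. *)
  rewrite cat_uniq cons_uniq; apply/and4P; split.
  - by rewrite map_inj_uniq ?enum_uniq //; apply: map_edges_inj.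
  - apply/hasPn => E; rewrite inE => /predU1P[->|/arc_part[j Ej]];
      apply/negP => /inners_part /(congr1 (fun B : {set 'I_3} => #|B|)).
      by rewrite hex_part_hexE cardsT cards0 card_ord.
    by rewrite Ej card_arc_key cards0; case: (j.1).
  - apply/negP => /arc_part[j] /(congr1 (fun B : {set 'I_3} => #|B|)).
    by rewrite hex_part_hexE cardsT card_ord card_arc_key; case: (j.1).
  apply: (@uniq_allpairs_key _ _ _ _ _ _ _ arc_key outer_part).
  - by rewrite map_inj_uniq ?enum_uniq //; apply: arc_key_inj.
  - exact: outer_part_arc.
  - by move=> j _; apply: uniq_path_list.
  - by move=> j _; apply: arc_cycle_edges_inj.
have -> : #|simple_cycles e| + 1 + 6 * N = size (inners ++ hexE :: arcs).
  rewrite size_cat size_map -cardE /= size_allpairs_dep -addnA add1n.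
  congr (_ + _.+1); rewrite sumnE big_map big_enum /=.
  rewrite (eq_bigr (fun=> N)) => [|j _].
    by rewrite sum_nat_const card_prod card_bool card_ord.
  rewrite size_path_list cardN //.
  by have [] := ordS_letters j.2.
rewrite -(card_uniqP uE); apply: eq_card => E; rewrite mem_cat in_cons.
apply/idP/idP => [/simple_cyclesP[c [c2 cc ->]]|].
  case: (cycle_edges_shape cc c2) => [[c0 [cc0 c02 ->]]|].
    rewrite cycle_edges_map //; last by case/andP: cc0.
    by rewrite map_f // mem_enum; apply/simple_cyclesP; exists c0.
  have in_arcs j p : p \in arc_paths j -> cycle_edges (arc_cycle j p) \in arcs.
    by move=> pj; apply/allpairsPdep; exists j, p; rewrite mem_enum.
  case=> x [y [z [c' [xy' xz' yz' -> ]]]] [->|[p pp ->]|[p pp ->]|[p pp ->]].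
  - by rewrite /hexE !cycle_edges_hexagon // eqxx orbT.
  - by have [p' pp' ->] := short_arc xy' xz' yz' pp; rewrite in_arcs ?orbT.
  - by have [p' pp' ->] := long_arc xy' xz' yz' pp; rewrite in_arcs ?orbT.
  (* Up to rotation the fourth shape is a long cycle for the letters [y], [z], [x] in this order. *)
  - rewrite eq_sym in xy'; rewrite eq_sym in xz'.
    have [p' pp' E'] := long_arc yz' xy' xz' pp.
    rewrite cycle_edges_rot ?E' ?in_arcs ?orbT //.
    exact: uniq_long_cycle pp.
case/or3P => [/mapP[E0]|/eqP->|/allpairsPdep[j [p [_ pj ->]]]].
- by rewrite mem_enum => E0c ->; apply: map_simple_cycle.
- apply/simple_cyclesP; exists (hexagon_cycle ord0 (ordS ord0) (ordS (ordS ord0))).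
  by split=> //; apply: hexagon_simple_cycle.
- have [cc c2] := arc_ucycle pj.
  by apply/simple_cyclesP; exists (arc_cycle j p).
Qed.

End Wrap.

(** * The recurrences, the base case and the closed formulas *)

Lemma card_simple_paths_wrap (G : tgraph) N :
  (forall u w, u != w -> #|simple_paths (@adj G) (outer G u) (outer G w)| = N) ->
  forall x y : 'I_3, x != y ->
    #|simple_paths (@wrap_adj G) (inl (inl x)) (inl (inl y))| = 5 * N + 2.
Proof.
move=> cardN x y xy.
have [z xz yz] := third_letter xy.
exact: (card_simple_paths_wrap_third xy xz yz cardN).
Qed.

Lemma card_simple_paths_triangle (x y : 'I_3) : x != y ->
  #|simple_paths (@adj (R 0)) x y| = 2.
Proof.
move=> xy.
have [z xz yz] := third_letter xy.
have neqE := (negbTE xy, negbTE xz, negbTE yz, eq_sym y x, eq_sym z x, eq_sym z y).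
rewrite (@card_simple_paths _ _ x y [:: [:: y]; [:: z; y]]) // => [|s].
  by rewrite /= !inE eqseq_cons !neqE.
rewrite !inE; apply/orP/and3P => [[]/eqP->|].
- by rewrite /= !inE !neqE.
- by rewrite /= !inE !neqE.
case=> ps us /eqP ls; case: s => [|a s] in ps us ls *.
  by rewrite /= in ls; rewrite ls eqxx in xy.
case: (letterP a xy xz yz) => aE; subst a.
- by rewrite /= mem_head in us.
- by left; case/andP: us => _ us; rewrite (uniq_last_nil us ls).
case: s => [|a s] in ps us ls *; first by rewrite -[y]ls eqxx in yz.
case: (letterP a xy xz yz) => aE; subst a.
- by rewrite /= !inE eqxx orbT in us.
- by right; case/and3P: us => _ _ us; rewrite (uniq_last_nil us ls).
- by rewrite /= !inE eqxx andbF in us.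
Qed.

(** A cycle needs three distinct vertices, hence runs through all of ['I_3] and uses every edge of
    the triangle. *)
Lemma card_simple_cycles_triangle : #|SC 0| = 1.
Proof.
have edgesE (c : seq 'I_3) : uniq c -> 2 < size c ->
    cycle_edges c = [set [set i.1; i.2] | i in [pred i : 'I_3 * 'I_3 | i.1 != i.2]].
  move=> uc; have : size c <= 3.
    by have := max_card (mem c); rewrite card_ord (card_uniqP uc).
  case: c uc => [|x [|y [|z [|//]]]] // uc _ _; rewrite cycle_edgesE //.
  have [xy xz yz] : [/\ x != y, x != z & y != z].
    by move: uc; rewrite /= !inE negb_or andbT => /andP[/andP[]].
  apply/setP => E; rewrite /= !in_setU1 in_set0 orbF; apply/idP/imsetP.
    case/or3P => /eqP->; [exists (x, y) | exists (y, z) | exists (z, x)] => //.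
    by rewrite inE eq_sym.
  case=> -[i j]; rewrite inE /= => ij ->.
  case: (letterP i xy xz yz) ij => ->; case: (letterP j xy xz yz) => ->;
    by rewrite ?eqxx // ?orbT // setUC eqxx ?orbT.
have [xy xz yz] := ordS_letters ord0.
have uc : uniq [:: ord0 : 'I_3; ordS ord0; ordS (ordS ord0)].
  by rewrite !cons_uniq !inE negb_or xy.
apply/eqP/cards1P; eexists; apply/setP => E; rewrite inE.
apply/simple_cyclesP/eqP => [[c [c2 /andP[_ uc'] ->]]|->]; first exact: edgesE.
by exists [:: ord0 : 'I_3; ordS ord0; ordS (ordS ord0)]; split; rewrite ?edgesE.
Qed.

(** The closed forms are cleared of fractions and subtractions. Paths are treated for all pairs of
    letters, as both recurrences require. *)
Lemma card_R (d : nat) :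
  4 * #|SC d| + 8 * d + 11 = 3 * 5 ^ d.+1 /\
  forall x y, x != y ->
    #|simple_paths (@adj (R d)) (outer (R d) x) (outer (R d) y)|.*2.+1 = 5 ^ d.+1.
Proof.
elim: d => [|d [IHc IHp]].
  by rewrite card_simple_cycles_triangle; split=> // x y /card_simple_paths_triangle->.
pose N := (5 ^ d.+1).-1./2.
have cardN u w : u != w ->
    #|simple_paths (@adj (R d)) (outer (R d) u) (outer (R d) w)| = N.
  by move=> uw; rewrite /N -(IHp u w uw) doubleK.
have N5 : N.*2.+1 = 5 ^ d.+1 by rewrite -(cardN la lb isT) IHp.
split=> [|x y xy].
  have [-> _] := tgraph_iso_card la lb (R_wrap_iso d).
  rewrite (card_simple_cycles_wrap (@R_sym d) cardN).
  (* The left side grows by [4 * (1 + 6 * N) + 8 = 12 * (2 * N + 1)], which turns the factor 3 of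
     [2 * N + 1] into 15. *)
  rewrite expnS -N5 -/(SC d); rewrite -N5 in IHc; lia.
have [_ ->] := tgraph_iso_card x y (R_wrap_iso d).
rewrite (card_simple_paths_wrap cardN xy) expnS -N5; lia.
Qed.

Local Open Scope ring_scope.

Theorem mainTheorem4 (d : nat) :
  [/\ #|SC d|%:R = 4%:R^-1 * (3%:R * 5%:R ^+ d.+1 - 8%:R * d%:R - 11%:R) :> rat,
      (5 ^ d <= #|SC d| <= 5 ^ d.+1)%N,
      #|SBL d|%:R = 2%:R^-1 * (5%:R ^+ d.+1 - 1) :> rat
    & (5 ^ d <= #|SBL d| <= 5 ^ d.+1)%N].
Proof.
have [SCd SPd] := card_R d.
have {SPd} SBLd : #|SBL d|.*2.+1 = (5 ^ d.+1)%N := SPd la lb isT.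
(* The lower bound for cycles amounts to [8 * d + 11 <= 11 * 5 ^ d], which follows from this. *)
have d5 : (d < 5 ^ d)%N by apply: ltn_expl.
split.
- have /(congr1 (fun n => n%:R : rat)) := SCd.
  rewrite 2!natrD !natrM natrX; lra.
- rewrite expnS in SCd *; lia.
- have /(congr1 (fun n => n%:R : rat)) := SBLd.
  rewrite -addn1 -muln2 natrD natrM natrX; lra.
- rewrite expnS in SBLd *; lia.
Qed.
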